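(* Let $E$ be a complex Banach space and $n\in\mathbb{N}$, let $(\mathcal{P}_{\Delta}(^{n}E),\|\cdot\|_{\Delta})$ and $(\mathcal{P}_{\Delta'}(^{n}E'),\|\cdot\|_{\Delta'})$ be spaces satisfying the standing assumptions of the context, and let $(\mathcal{P}_{\widetilde{\Delta}}(^{n}E),\|\cdot\|_{\widetilde{\Delta}})$ be the completion of $(\mathcal{P}_{\Delta}(^{n}E),p_{U^{\circ\circ}})$. Then the linear mapping $$\widetilde{\mathcal{B}}\colon\left(\mathcal{P}_{\widetilde{\Delta}}(^{n}E)',\|\cdot\|\right)\longrightarrow\left(\mathcal{P}_{\Delta'}(^{n}E'),\|\cdot\|_{\Delta'}\right),\qquad \widetilde{\mathcal{B}}(T)(\varphi)=T(\varphi^{n})\quad(\varphi\in E'),$$ is a topological isomorphism.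
   Context: $E'$ is the topological dual of $E$. $\mathcal{P}(^{n}E)$ is the Banach space of continuous $n$-homogeneous polynomials $E\to\mathbb{C}$ with $\|P\|=\sup_{\|x\|\le1}|P(x)|$. For $\varphi\in E'$, $\varphi^{n}(x)=\varphi(x)^{n}$; $\mathcal{P}_{f}(^{n}E)$ (polynomials of finite type) is the linear span of $\{\varphi^{n}:\varphi\in E'\}$. Standing assumptions. $(\mathcal{P}_{\Delta}(^{n}E),\|\cdot\|_{\Delta})$ is a quasi-normed space of $n$-homogeneous polynomials on $E$ with $\mathcal{P}_{f}(^{n}E)\subset\mathcal{P}_{\Delta}(^{n}E)\subset\mathcal{P}(^{n}E)$ and with continuous inclusion into $\mathcal{P}(^{n}E)$; $C_{\Delta_{n}}>0$ is a constant with $\|P\|\le C_{\Delta_{n}}\|P\|_{\Delta}$ for all $P\in\mathcal{P}_{\Delta}(^{n}E)$. $(\mathcal{P}_{\Delta'}(^{n}E'),\|\cdot\|_{\Delta'})$ is a normed space, $\mathcal{P}_{\Delta'}(^{n}E')\subset\mathcal{P}(^{n}E')$, such that the Borel transform $\mathcal{B}\colon(\mathcal{P}_{\Delta}(^{n}E)',\|\cdot\|)\to(\mathcal{P}_{\Delta'}(^{n}E'),\|\cdot\|_{\Delta'})$, $\mathcal{B}(T)(\varphi)=T(\varphi^{n})$, is a topological isomorphism. Here $\mathcal{P}_{\Delta}(^{n}E)'$ is the space of continuous linear functionals with $\|T\|=\sup\{|T(P)|:\|P\|_{\Delta}\le1\}$. The norm $p_{U^{\circ\circ}}$. Put $\langle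 P,Q\rangle=\mathcal{B}^{-1}(Q)(P)$ for $P\in\mathcal{P}_{\Delta}(^{n}E)$, $Q\in\mathcal{P}_{\Delta'}(^{n}E')$ (this is a dual system). Let $U=\{P\in\mathcal{P}_{\Delta}(^{n}E):\|P\|_{\Delta}\le1\}$, $U^{\circ}=\{Q\in\mathcal{P}_{\Delta'}(^{n}E'):|\langle P,Q\rangle|\le1\ \forall P\in U\}$, $U^{\circ\circ}=\{P\in\mathcal{P}_{\Delta}(^{n}E):|\langle P,Q\rangle|\le1\ \forall Q\in U^{\circ}\}$, and $p_{U^{\circ\circ}}(P)=\inf\{\delta>0:P\in\delta U^{\circ\circ}\}$, which is a norm on $\mathcal{P}_{\Delta}(^{n}E)$. $(\mathcal{P}_{\widetilde{\Delta}}(^{n}E),\|\cdot\|_{\widetilde{\Delta}})$ denotes the completion of $(\mathcal{P}_{\Delta}(^{n}E),p_{U^{\circ\circ}})$, so $\|\cdot\|_{\widetilde{\Delta}}$ restricts to $p_{U^{\circ\circ}}$ on $\mathcal{P}_{\Delta}(^{n}E)$. Its dual carries the usual dual norm. *)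

(* Defs.v *)
From HB Require Import structures.
From mathcomp Require Import all_boot all_order all_algebra.
From mathcomp Require Import all_classical all_reals.
From mathcomp Require Import topology normedtype.
From mathcomp Require Import complex.

Set Implicit Arguments.
Unset Strict Implicit.
Unset Printing Implicit Defensive.

Import Order.TTheory GRing.Theory Num.Theory.
Import numFieldNormedType.Exports.
Import Normc.

Local Open Scope classical_set_scope.
Local Open Scope ring_scope.
Local Open Scope complex_scope.

(* Norms on modules over R[i] take values in R[i]; [rnorm x] is the same norm
   seen as an element of R. *)
Definition rnorm (R : realType) (V : normedModType R[i]) (x : V) : R :=
  complex.Re `|x|.

Section Rnorm.
Context {R : realType} {V : normedModType R[i]}.
Implicit Types x y : V.

Lemma rnormE x : (rnorm x)%:C = `|x|.
Proof.
rewrite /rnorm; have := normr_ge0 x.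
by case: `|x|%R => a b; rewrite lecE /= => /andP[/eqP-> _].
Qed.

Lemma rnorm_ge0 x : 0 <= rnorm x.
Proof. by rewrite -lecR rnormE; exact: normr_ge0. Qed.

Lemma rnorm0_eq0 x : rnorm x = 0 -> x = 0.
Proof. by move=> x0; apply/normr0_eq0; rewrite -rnormE x0. Qed.

Lemma normcEC (a : R[i]) : (normc a)%:C = `|a|.
Proof. by case: a => a b; rewrite normc_def. Qed.

Lemma normc_real (r : R) : 0 <= r -> normc r%:C = r.
Proof.
move=> r0; have -> : normc r%:C = Num.sqrt (r ^+ 2 + 0 ^+ 2) by [].
by rewrite expr0n /= addr0 sqrtr_sqr ger0_norm.
Qed.

Lemma rnormZ (a : R[i]) x : rnorm (a *: x) = normc a * rnorm x.
Proof. by apply: complexI; rewrite rmorphM /= !rnormE normcEC normrZ. Qed.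

Lemma ler_rnormD x y : rnorm (x + y) <= rnorm x + rnorm y.
Proof. by rewrite -lecR rmorphD /= !rnormE ler_normD. Qed.

Lemma nbhs_rnorm x :
  nbhs x = filter_from [set e : R | 0 < e] (fun e => [set y | rnorm (y - x) < e]).
Proof.
apply/seteqP; split=> A.
- move=> /nbhs_normP[e /= e0 eA].
  have eE : e = (complex.Re e)%:C.
    by move: e0; case: (e) => a b; rewrite ltcE /= => /andP[/eqP-> _].
  exists (complex.Re e) => /=; first by rewrite -ltcR -eE.
  move=> y /=; rewrite -ltcR rnormE -eE => yx.
  by apply: eA; rewrite /= distrC.
- move=> [e /= e0 eA]; apply/nbhs_normP; exists e%:C => /=; first by rewrite ltcR.
  by move=> y /= xy; apply: eA => /=; rewrite -ltcR rnormE distrC.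
Qed.

End Rnorm.

Record quasiNorm (R : realType) (V : preTopologicalLmodType R[i]) := QuasiNorm {
  qnorm :> V -> R ;
  qnorm_ge0 : forall x, 0 <= qnorm x ;
  qnorm0_eq0 : forall x, qnorm x = 0 -> x = 0 ;
  qnormZ : forall (a : R[i]) x, qnorm (a *: x) = normc a * qnorm x ;
  ler_qnormD : exists K : R, 1 <= K /\
    forall x y, qnorm (x + y) <= K * (qnorm x + qnorm y) ;
  (* the topology of V is the one induced by the quasi-norm; the balls are a
     basis of neighbourhoods but need not be open *)
  nbhs_qnorm : forall x, nbhs x =
    filter_from [set e : R | 0 < e] (fun e => [set y | qnorm (y - x) < e]) }.

Lemma ler_rnormD1 (R : realType) (V : normedModType R[i]) :
  exists K : R, 1 <= K /\
    forall x y : V, rnorm (x + y) <= K * (rnorm x + rnorm y).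
Proof. by exists 1; split=> // x y; rewrite mul1r ler_rnormD. Qed.

Definition norm_qn (R : realType) (V : normedModType R[i]) : quasiNorm V :=
  QuasiNorm rnorm_ge0 rnorm0_eq0 rnormZ (ler_rnormD1 V) nbhs_rnorm.

Section SupNorm.
Context {R : realType} {T : Type} (D : set T).
Implicit Types f g : T -> R[i]^o.

Definition supnorm f : R := sup [set normc (f x) | x in D].

Definition bounded_over f := exists M : R, forall x, D x -> normc (f x) <= M.

Lemma le_supnorm f x : bounded_over f -> D x -> normc (f x) <= supnorm f.
Proof.
move=> [M fM] Dx; apply: ub_le_sup; last by exists x.
by exists M => _ [y Dy <-]; exact: fM.
Qed.

Lemma supnorm_le f (M : R) : D !=set0 ->
  (forall x, D x -> normc (f x) <= M) -> supnorm f <= M.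
Proof.
move=> [x0 Dx0] fM; apply: ge_sup; first by exists (normc (f x0)); exists x0.
by move=> _ [y Dy <-]; exact: fM.
Qed.

Lemma supnormD f g : D !=set0 -> bounded_over f -> bounded_over g ->
  supnorm (f \+ g) <= supnorm f + supnorm g.
Proof.
move=> D0 bf bg; apply: supnorm_le => // x Dx /=.
by apply: (le_trans (le_normcD _ _)); apply: lerD; exact: le_supnorm.
Qed.

Lemma normc_ge0 (z : R[i]) : 0 <= normc z.
Proof. by case: z => a b; exact: sqrtr_ge0. Qed.

Lemma supnorm_ge0 f : D !=set0 -> bounded_over f -> 0 <= supnorm f.
Proof.
by move=> [x Dx] bf; rewrite (le_trans (normc_ge0 (f x)))// le_supnorm.
Qed.

Lemma supnormZ (a : R[i]) f : D !=set0 -> bounded_over f ->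
  supnorm (fun x => a * f x) = normc a * supnorm f.
Proof.
move=> D0 bf; apply/eqP; rewrite eq_le; apply/andP; split.
  apply: supnorm_le => // x Dx; rewrite normcM ler_wpM2l ?normc_ge0//.
  exact: le_supnorm.
have [->|a0] := eqVneq a 0.
  rewrite normc0 mul0r; case: D0 => x Dx.
  apply: (le_trans _ (le_supnorm (x := x) _ Dx)); first exact: normc_ge0.
  by exists 0 => y _; rewrite mul0r normc0.
have na0 : 0 < normc a.
  by rewrite lt_neqAle normc_ge0 andbT eq_sym; apply: contra a0 => /eqP/eq0_normc->.
rewrite -ler_pdivlMl//; apply: supnorm_le => // x Dx.
rewrite ler_pdivlMl// -normcM.
apply: (@le_supnorm (fun x => a * f x)) => //.
case: bf => M fM; exists (normc a * M) => y Dy.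
by rewrite normcM ler_wpM2l ?normc_ge0// fM.
Qed.

Lemma supnorm_eq0 f x : bounded_over f -> supnorm f = 0 -> D x -> f x = 0.
Proof.
move=> bf f0 Dx; apply: eq0_normc; apply/eqP.
by rewrite eq_le normc_ge0 andbT -f0 le_supnorm.
Qed.

End SupNorm.

Section ContinuousLinearFunctionals.
Context {R : realType} {V : preTopologicalLmodType R[i]}.

Definition clf_pred : {pred V -> R[i]^o} :=
  mem [set f : V -> R[i]^o | linear f /\ continuous f].

Record clf := Clf {
  clf_fun :> V -> R[i]^o ;
  clfP : clf_fun \in clf_pred }.

HB.instance Definition _ := [isSub for clf_fun].
HB.instance Definition _ := [Choice of clf by <:].

Fact clf_submod : submod_closed clf_pred.
Proof.
split=> [|a f g].
  apply/mem_set; split; last by move=> x; exact: cvg_cst.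
  by move=> a u v; rewrite /= scaler0 addr0.
move=> /set_mem[fl fc] /set_mem[gl gc]; apply/mem_set; split.
  move=> b u v.
  have fgE w : (a *: f + g) w = a *: f w + g w by [].
  by rewrite !fgE fl gl !scalerDr !scalerA mulrC addrACA.
by move=> x; apply: cvgD; [apply: cvgZr; exact: fc|exact: gc].
Qed.

HB.instance Definition _ :=
  GRing.isSubmodClosed.Build _ _ clf_pred clf_submod.
HB.instance Definition _ := [SubChoice_isSubLmodule of clf by <:].

Lemma clf_linear (f : clf) : linear f.
Proof. by have /set_mem[] := clfP f. Qed.

Lemma clf_continuous (f : clf) : continuous f.
Proof. by have /set_mem[] := clfP f. Qed.

Lemma clf0 (f : clf) : f 0 = 0.
Proof.
have := clf_linear f 1 0 0; rewrite !scale1r addr0 => /eqP.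
by rewrite -subr_eq0 opprD addrA subrr add0r oppr_eq0 => /eqP.
Qed.

Lemma clfZ (f : clf) (a : R[i]) x : f (a *: x) = a * f x.
Proof. by have := clf_linear f a x 0; rewrite clf0 !addr0. Qed.

End ContinuousLinearFunctionals.
Arguments clf {R} V.

(* The carrier does not mention q, whose topology is that of V; q selects the
   dual norm. *)
Definition dual (R : realType) (V : preTopologicalLmodType R[i])
  (q : quasiNorm V) : Type := clf V.

Section Dual.
Context {R : realType} {V : preTopologicalLmodType R[i]} (q : quasiNorm V).
Local Notation dual := (dual q).

HB.instance Definition _ := GRing.Lmodule.copy dual (clf V).

Definition qball : set V := [set x | q x <= 1].

Lemma qball0 : qball !=set0.
Proof.
exists 0; rewrite /qball /= -(scale0r 0) qnormZ normc0 mul0r.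
exact: ler01.
Qed.

Lemma dual_bounded (f : dual) : bounded_over qball f.
Proof.
have /cvgr0Pnorm_lt/(_ 1 ltr01) : f y @[y --> (0 : V)] --> (0 : R[i]^o).
  by rewrite -[X in _ --> X](clf0 f); exact: clf_continuous.
rewrite near_simpl /prop_near1 (nbhs_qnorm q) => -[e /= e0 fe].
exists (2 / e) => x; rewrite /qball /= => qx.
have e20 : 0 < e / 2 by rewrite divr_gt0.
have : normc (f ((e / 2)%:C *: x)) < 1.
  rewrite -ltcR normcEC; apply: fe; rewrite /= subr0 qnormZ (normc_real (ltW e20)).
  apply: (@le_lt_trans _ _ (e / 2)); first by rewrite ler_piMr// ltW.
  by rewrite ltr_pdivrMr// mulr_natr mulr2n ltrDl.
rewrite clfZ normcM (normc_real (ltW e20)) => fx1.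
by apply: ltW; rewrite -[ltRHS]mulr1 -invf_div ltr_pdivlMl.
Qed.

Lemma le_dual_norm (f : dual) x : normc (f x) <= supnorm qball f * q x.
Proof.
have [/eqP qx0|qx0] := boolP (q x == 0).
  rewrite (qnorm0_eq0 qx0) clf0 normc0 mulr_ge0 ?qnorm_ge0//.
  by apply: supnorm_ge0; [exact: qball0|exact: dual_bounded].
have qx_gt0 : 0 < q x by rewrite lt_neqAle eq_sym qx0 qnorm_ge0.
have nq : normc (q x)^-1%:C = (q x)^-1.
  by apply: complexI; rewrite normcEC ger0_norm// lecR invr_ge0 qnorm_ge0.
have : normc (f ((q x)^-1%:C *: x)) <= supnorm qball f.
  apply: le_supnorm; first exact: dual_bounded.
  by rewrite /qball /= qnormZ nq mulVf.
by rewrite clfZ normcM nq ler_pdivrMl// mulrC.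
Qed.

Definition dual_norm (f : dual) : R[i] := (supnorm qball f)%:C.

Fact ler_dual_normD (f g : dual) : dual_norm (f + g) <= dual_norm f + dual_norm g.
Proof.
by rewrite /dual_norm -rmorphD lecR supnormD//; [exact: qball0|exact: dual_bounded..].
Qed.

Fact dual_normZ (a : R[i]) (f : dual) : dual_norm (a *: f) = `|a| * dual_norm f.
Proof.
rewrite /dual_norm -normcEC -rmorphM -supnormZ//; first exact: qball0.
exact: dual_bounded.
Qed.

Fact dual_norm0_eq0 (f : dual) : dual_norm f = 0 -> f = 0.
Proof.
move=> [/= f0]; apply/val_inj/funext => x /=.
apply: eq0_normc; apply/eqP; rewrite eq_le normc_ge0 andbT.
by rewrite (le_trans (le_dual_norm f x))// f0 mul0r.
Qed.

HB.instance Definition _ := Lmodule_isNormed.Build R[i] dual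
  ler_dual_normD dual_normZ dual_norm0_eq0.

End Dual.

Section HomogeneousPolynomials.
Context {R : realType} (V : normedModType R[i]) (n : nat).

Definition multilinear (A : ('I_n -> V) -> R[i]^o) :=
  forall (x : 'I_n -> V) (k : 'I_n) (a : R[i]) (u v : V),
    A [eta x with k |-> a *: u + v] =
    a * A [eta x with k |-> u] + A [eta x with k |-> v].

Definition homogeneous (P : V -> R[i]^o) :=
  exists2 A : ('I_n -> V) -> R[i]^o, multilinear A & forall x, P x = A (fun=> x).

Definition hpoly_pred : {pred V -> R[i]^o} :=
  mem [set P : V -> R[i]^o | homogeneous P /\ continuous P].

Record hpoly := HPoly {
  hpoly_fun :> V -> R[i]^o ;
  hpolyP : hpoly_fun \in hpoly_pred }.

HB.instance Definition _ := [isSub for hpoly_fun].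
HB.instance Definition _ := [Choice of hpoly by <:].

Fact hpoly_submod : submod_closed hpoly_pred.
Proof.
split=> [|a f g].
  apply/mem_set; split; last by move=> x; exact: cvg_cst.
  by exists (fun=> 0) => // x k a u v; rewrite mulr0 addr0.
move=> /set_mem[[A Al fA] fc] /set_mem[[B Bl gB] gc]; apply/mem_set; split.
  exists (fun x => a * A x + B x).
    by move=> x k b u v; rewrite Al Bl !mulrDr !mulrA (mulrC a b) addrACA.
  have fgE w : (a *: f + g) w = a * f w + g w by [].
  by move=> x; rewrite fgE fA gB.
by move=> x; apply: cvgD; [apply: cvgZr; exact: fc|exact: gc].
Qed.

HB.instance Definition _ :=
  GRing.isSubmodClosed.Build _ _ hpoly_pred hpoly_submod.
HB.instance Definition _ := [SubChoice_isSubLmodule of hpoly by <:].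

Lemma hpoly_continuous (P : hpoly) : continuous P.
Proof. by have /set_mem[] := hpolyP P. Qed.

Lemma multilinearZ A (a : R[i]) (x : V) : multilinear A ->
  A (fun=> a *: x) = a ^+ n * A (fun=> x).
Proof.
move=> Al.
have AZ y k u : A [eta y with k |-> a *: u] = a * A [eta y with k |-> u].
  have A0 : A [eta y with k |-> 0] = 0.
    have := Al y k 1 0 0; rewrite scale1r addr0 mul1r => /eqP.
    by rewrite -subr_eq0 opprD addrA subrr add0r oppr_eq0 => /eqP.
  by have := Al y k a u 0; rewrite A0 !addr0.
have step m : (m <= n)%N ->
    A (fun i : 'I_n => if (i < m)%N then a *: x else x) = a ^+ m * A (fun=> x).
  elim: m => [_|m IHm mn]; first by rewrite expr0 mul1r.
  rewrite exprS -mulrA -IHm ?(ltnW mn)//.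
  pose y (i : 'I_n) := if (i < m)%N then a *: x else x.
  have -> : (fun i : 'I_n => if (i < m.+1)%N then a *: x else x) =
            [eta y with Ordinal mn |-> a *: x].
    apply/funext => i /=; rewrite /y ltnS leq_eqVlt -val_eqE /=.
    by case: eqP.
  rewrite AZ; congr (_ * A _); apply/funext => i /=; rewrite /y -val_eqE /=.
  by case: eqP => // ->; rewrite ltnn.
have := step n (leqnn n); congr (A _ = _).
by apply/funext => i; rewrite ltn_ord.
Qed.

Lemma hpolyZ (P : hpoly) (a : R[i]) x : P (a *: x) = a ^+ n * P x.
Proof.
have /set_mem[[A Al PA] _] := hpolyP P.
by rewrite !PA multilinearZ.
Qed.

Definition unit_ball : set V := [set x | `|x| <= 1].

Lemma unit_ball0 : unit_ball !=set0.
Proof. by exists 0; rewrite /unit_ball /= normr0 ler01. Qed.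

Lemma hpoly_bounded (P : hpoly) : bounded_over unit_ball P.
Proof.
have /cvgrPdist_lt/(_ 1 ltr01) := @hpoly_continuous P 0.
rewrite near_simpl /prop_near1 nbhs_rnorm => -[e /= e0 fe].
have e20 : 0 < e / 2 by rewrite divr_gt0.
have ne : normc (e / 2)%:C = e / 2.
  by apply: complexI; rewrite normcEC ger0_norm// lecR ltW.
exists (((e / 2) ^+ n)^-1 * (1 + normc (P 0))) => x.
rewrite /unit_ball /= => x1.
have nx1 : rnorm x <= 1 by rewrite -lecR rnormE.
have : `|P 0 - P ((e / 2)%:C *: x)| < 1.
  apply: fe; rewrite /= subr0 rnormZ ne.
  apply: (@le_lt_trans _ _ (e / 2)); first by rewrite ler_piMr// ltW.
  by rewrite ltr_pdivrMr// mulr_natr mulr2n ltrDl.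
rewrite -ler_pdivrMl ?invr_gt0 ?exprn_gt0// invrK => P01.
have -> : (e / 2) ^+ n * normc (P x) = normc (P ((e / 2)%:C *: x)).
  apply: complexI; rewrite hpolyZ rmorphM rmorphXn /= !normcEC normrM normrX.
  by rewrite -(normcEC (e / 2)%:C) ne.
rewrite -lecR rmorphD /= !normcEC.
rewrite -[X in `|X|](subrK (P 0)) (le_trans (ler_normD _ _))// lerD2r.
by rewrite distrC ltW.
Qed.

Definition hpoly_norm (P : hpoly) : R[i] := (supnorm unit_ball P)%:C.

Fact ler_hpoly_normD (P Q : hpoly) :
  hpoly_norm (P + Q) <= hpoly_norm P + hpoly_norm Q.
Proof.
rewrite /hpoly_norm -rmorphD lecR supnormD//; first exact: unit_ball0.
- exact: hpoly_bounded.
- exact: hpoly_bounded.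
Qed.

Fact hpoly_normZ (a : R[i]) (P : hpoly) : hpoly_norm (a *: P) = `|a| * hpoly_norm P.
Proof.
rewrite /hpoly_norm -normcEC -rmorphM -supnormZ//; first exact: unit_ball0.
exact: hpoly_bounded.
Qed.

Fact hpoly_norm0_eq0 (P : hpoly) : hpoly_norm P = 0 -> P = 0.
Proof.
move=> [/= P0]; apply/val_inj/funext => x /=.
have PB := supnorm_eq0 (hpoly_bounded P) P0.
have [x0|x0] := eqVneq `|x| 0.
  by apply: PB; rewrite /unit_ball /= x0 ler01.
have /eqP : P (`|x|^-1 *: x) = 0.
  by apply: PB; rewrite /unit_ball /= normrZ normrV ?unitfE// normr_id mulVf.
by rewrite hpolyZ mulf_eq0 expf_eq0 invr_eq0 (negbTE x0) andbF /= => /eqP.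
Qed.

HB.instance Definition _ := Lmodule_isNormed.Build R[i] hpoly
  ler_hpoly_normD hpoly_normZ hpoly_norm0_eq0.

End HomogeneousPolynomials.

Notation topdual V := (dual (norm_qn V)).

Lemma expr_continuous (K : numFieldType) (n : nat) :
  continuous (fun z : K => z ^+ n).
Proof.
elim: n => [|n IHn] z; first exact: cst_continuous.
have -> : (fun y : K => y ^+ n.+1) = (fun y => y * y ^+ n).
  by apply/funext => y; rewrite exprS.
exact: (@cvgM K K (nbhs z) _ id (fun y => y ^+ n) z (z ^+ n) cvg_id (IHn z)).
Qed.

Section FiniteType.
Context {R : realType} {E : normedModType R[i]} (n : nat).

Fact hpow_subproof (phi : topdual E) :
  (fun x => phi x ^+ n : R[i]^o) \in hpoly_pred n.
Proof.
apply/mem_set; split; last first.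
  move=> x; apply: (@continuous_comp _ _ _ phi (fun z : R[i]^o => z ^+ n)).
    exact: clf_continuous.
  exact: (@expr_continuous R[i]).
exists (fun x => \prod_(i < n) phi (x i)); last first.
  by move=> x; rewrite prodr_const card_ord.
move=> x k a u v.
have prodE w : \prod_(i < n) phi ([eta x with k |-> w] i) =
               phi w * \prod_(i < n | i != k) phi (x i).
  rewrite (bigD1 k)//= eqxx; congr (_ * _).
  by apply: eq_bigr => i /negbTE ->.
by rewrite !prodE clf_linear mulrDl mulrA.
Qed.

Definition hpow (phi : topdual E) : hpoly E n := HPoly (hpow_subproof phi).

Definition finite_type : set (hpoly E n) :=
  [set P | exists m (c : 'I_m -> R[i]) (phi : 'I_m -> topdual E),
    P = \sum_(k < m) c k *: hpow (phi k)].

End FiniteType.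
Arguments hpow {R E} n phi.
Arguments finite_type {R} E n.

(* Linear homeomorphisms, packaged with their inverse. *)
Record topIso (R : realType) (F G : normedModType R[i]) := TopIso {
  iso_fun :> {linear F -> G} ;
  iso_inv : G -> F ;
  iso_funK : cancel iso_fun iso_inv ;
  iso_invK : cancel iso_inv iso_fun ;
  iso_continuous : continuous iso_fun ;
  iso_inv_continuous : continuous iso_inv }.

Section Polars.
Context {R : realType} {V : preTopologicalLmodType R[i]} {q : quasiNorm V}.
Context {W : normedModType R[i]} (B : topIso (dual q) W).

Definition pairing (P : V) (Q : W) : R[i] := iso_inv B Q P.

Definition polar (U : set V) : set W :=
  [set Q | forall P, U P -> `|pairing P Q| <= 1].

Definition prepolar (S : set W) : set V :=
  [set P | forall Q, S Q -> `|pairing P Q| <= 1].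

Definition bipolar_gauge (P : V) : R :=
  inf [set d : R | 0 < d /\
    exists2 P', prepolar (polar (qball q)) P' & P = d%:C *: P'].

End Polars.

(* (X, k) is a completion of the module V with norm p: a Banach space with a
   linear isometry of (V, p) onto a dense subspace. *)
Definition is_completion (R : realType) (V : lmodType R[i]) (p : V -> R)
    (X : completeNormedModType R[i]) (k : {linear V -> X}) : Prop :=
  (forall x, rnorm (k x) = p x) /\ dense (range k).

(* Main.v *)
Require Import Defs.
From HB Require Import structures.
From mathcomp Require Import all_boot all_order all_algebra.
From mathcomp Require Import all_classical all_reals.
From mathcomp Require Import topology normedtype.
From mathcomp Require Import complex.

Set Implicit Arguments.
Unset Strict Implicit.
Unset Printing Implicit Defensive.

Import Order.TTheory GRing.Theory Num.Theory.
Import numFieldNormedType.Exports.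
Import Normc.

Local Open Scope classical_set_scope.
Local Open Scope ring_scope.
Local Open Scope complex_scope.

(** Composition with [k] is an isomorphism from the dual of the completion
    [X] onto the dual of [(PD, qD)], and [Bt] is [B] after it.

    The reason is that [p], the gauge of the bipolar of the unit ball, defines
    the same continuous functionals as [qD].  The polar of the unit ball is
    the image under [B] of the unit ball of the dual, so
    [p P = sup {|T P| : ||T|| <= 1}].  Two inequalities come out of this:
    [p <= qD] ([bipolar_gauge_le]), which makes [T \o k] continuous for [qD]
    with norm at most that of [T]; and [|T P| <= ||T|| p P]
    ([le_bipolar_gauge]), by which every functional continuous for [qD] is
    bounded with respect to [p], hence extends from the dense range of [k] to
    [X] ([dense_extension]).

    The extension is made without completeness of the scalars.  The infimum
    formula of McShane extends the real and the imaginary part to Lipschitz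
    functions on [X]; if [|S v| <= M ||k v||], the resulting [f] satisfies
    [|f x - S v| <= 2 M ||x - k v||] for all [x] and [v], which gives
    linearity, by density, and boundedness, at [v = 0].  The factor 2 comes
    from treating the two parts separately; it is harmless, as the inverse
    only has to be continuous. *)

(** * Estimates for norms *)

Lemma rnorm0 (R : realType) (V : normedModType R[i]) : rnorm (0 : V) = 0.
Proof. by rewrite /rnorm normr0. Qed.

Lemma rnorm_distC (R : realType) (V : normedModType R[i]) (x y : V) :
  rnorm (x - y) = rnorm (y - x).
Proof. by rewrite /rnorm distrC. Qed.

Lemma rnormN (R : realType) (V : normedModType R[i]) (x : V) :
  rnorm (- x) = rnorm x.
Proof. by rewrite /rnorm normrN. Qed.

Lemma ler_rnorm_distD (R : realType) (V : normedModType R[i]) (z x y : V) :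
  rnorm (x - y) <= rnorm (x - z) + rnorm (z - y).
Proof. by rewrite (le_trans _ (ler_rnormD _ _))// addrA subrK. Qed.

Lemma rnorm_normc (R : realType) (z : R[i]) : rnorm (z : R[i]^o) = normc z.
Proof. by apply: complexI; rewrite rnormE; exact/esym/normcEC. Qed.

Lemma rnorm_dual (R : realType) (V : preTopologicalLmodType R[i])
  (q : quasiNorm V) (T : dual q) : rnorm T = supnorm (qball q) T.
Proof. by []. Qed.

Lemma normc_le_ReIm (R : realType) (z : R[i]) :
  normc z <= `|complex.Re z| + `|complex.Im z|.
Proof.
case: z => a b /=.
rewrite -[leRHS]ger0_norm ?addr_ge0// -sqrtr_sqr ler_wsqrtr//.
by rewrite sqrrD !real_normK ?num_real// lerD2r lerDl mulrn_wge0// mulr_ge0.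
Qed.

Lemma Re_le_normc (R : realType) (z : R[i]) : complex.Re z <= normc z.
Proof.
case: z => a b /=; rewrite (le_trans (ler_norm a))// -sqrtr_sqr ler_wsqrtr//.
by rewrite lerDl sqr_ge0.
Qed.

Lemma Im_le_normc (R : realType) (z : R[i]) : complex.Im z <= normc z.
Proof.
case: z => a b /=; rewrite (le_trans (ler_norm b))// -sqrtr_sqr ler_wsqrtr//.
by rewrite lerDr sqr_ge0.
Qed.

Lemma small_eq0 (R : realType) (a c : R) : 0 <= a ->
  (forall e, 0 < e -> a <= c * e) -> a = 0.
Proof.
move=> a0 ac; apply/eqP; rewrite eq_le a0 andbT; apply/ler_addgt0Pr => e e0.
have c1 : 0 < `|c| + 1 by rewrite ltr_wpDl.
rewrite add0r (le_trans (ac (e / (`|c| + 1)) _)) ?divr_gt0//.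
rewrite mulrA ler_pdivrMr// mulrC ler_wpM2l ?(ltW e0)//.
by rewrite (le_trans (ler_norm c))// lerDl.
Qed.

(** Stated for a quasi-norm on the source so as to serve for maps out of the
    quasi-normed space and, through [norm_qn], for maps between normed
    spaces. *)
Lemma lipschitz_continuous (R : realType) (V : preTopologicalLmodType R[i])
  (q : quasiNorm V) (W : normedModType R[i]) (f : V -> W) (M : R) :
  (forall x y, rnorm (f y - f x) <= M * q (y - x)) -> continuous f.
Proof.
move=> fM x A; rewrite nbhs_rnorm => -[e /= e0 eA].
have M1 : 0 < `|M| + 1 by rewrite ltr_wpDl.
rewrite /= nbhs_simpl /= (nbhs_qnorm q).
exists (e / (`|M| + 1)) => /=; first by rewrite divr_gt0.
move=> y /= yx; apply: eA => /=; apply: le_lt_trans (fM _ _) _.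
apply: (@le_lt_trans _ _ ((`|M| + 1) * q (y - x))).
  rewrite ler_wpM2r ?qnorm_ge0//.
  by rewrite (le_trans (ler_norm M))// lerDl.
by rewrite mulrC -ltr_pdivlMr.
Qed.

Lemma dense_approx (R : realType) (V : Type) (X : normedModType R[i])
  (k : V -> X) : dense (range k) ->
  forall (x : X) (e : R), 0 < e -> exists v, rnorm (x - k v) < e.
Proof.
move=> kd x e e0.
have xB : nbhs x [set y | rnorm (y - x) < e].
  by rewrite nbhs_rnorm; exists e.
have [|y [yx [v _ kvy]]] := kd (interior [set y | rnorm (y - x) < e]) _ (open_interior _).
  by exists x.
by exists v; rewrite kvy rnorm_distC; exact: (interior_subset yx).
Qed.

(** * Extension of functionals from a dense range *)

(** McShane's extension: the infimum taken for [g x] is the largest value at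
    [x] compatible with the Lipschitz condition.  At [x = k v] the
    conclusion says that [g] extends [u]. *)
Lemma mcshane_extension (R : realType) (V : Type)
  (X : normedModType R[i]) (k : V -> X) (u : V -> R) (M : R) : 0 <= M ->
  (forall v w, u v - u w <= M * rnorm (k v - k w)) ->
  exists g : X -> R, forall x v, `|g x - u v| <= M * rnorm (x - k v).
Proof.
move=> M0 uM.
exists (fun x => inf (range (fun v => u v + M * rnorm (x - k v)))) => x v.
have lb w : lbound (range (fun v => u v + M * rnorm (x - k v)))
                   (u w - M * rnorm (x - k w)).
  move=> _ [z _ <-]; rewrite lerBlDr -addrA -lerBlDl (le_trans (uM w z))//.
  by rewrite -mulrDr ler_wpM2l// [leRHS]addrC (rnorm_distC _ (k w)) ler_rnorm_distD.
rewrite ler_distl; apply/andP; split.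
  by apply: lb_le_inf; [exists (u v + M * rnorm (x - k v)), v|exact: lb].
by apply: ge_inf; [eexists; exact: lb|exists v].
Qed.

(** Real and imaginary parts are extended separately.  Linearity is then the
    vanishing of a defect that density makes arbitrarily small:
    replacing [x] and [y] by nearby [k v] and [k w] turns it into the defect
    of [S], which is zero. *)
Lemma dense_extension (R : realType) (V : lmodType R[i])
  (X : normedModType R[i]) (k : {linear V -> X}) (S : V -> R[i]^o) (M : R) :
  0 <= M -> dense (range k) -> linear S ->
  (forall v, normc (S v) <= M * rnorm (k v)) ->
  exists f : topdual X,
    (forall v, f (k v) = S v) /\ rnorm f <= M + M.
Proof.
move=> M0 kd Sl SM.
have SB v w : S (v - w) = S v - S w := zmod_morphism_linear Sl v w.
have S0 : S 0 = 0 by rewrite -(subrr 0) SB subrr.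
have SkM v w : normc (S v - S w) <= M * rnorm (k v - k w).
  by rewrite -SB -raddfB; exact: SM.
have [g gS] : exists g : X -> R, forall x v,
    `|g x - complex.Re (S v)| <= M * rnorm (x - k v).
  apply: (@mcshane_extension _ _ _ k (fun v => complex.Re (S v))) => //= v w.
  by rewrite -raddfB (le_trans (Re_le_normc _)).
have [h hS] : exists h : X -> R, forall x v,
    `|h x - complex.Im (S v)| <= M * rnorm (x - k v).
  apply: (@mcshane_extension _ _ _ k (fun v => complex.Im (S v))) => //= v w.
  by rewrite -raddfB (le_trans (Im_le_normc _)).
pose f x : R[i]^o := g x +i* h x.
have fS x v : normc (f x - S v) <= (M + M) * rnorm (x - k v).
  rewrite (le_trans (normc_le_ReIm _))// mulrDl !raddfB/=.
  by rewrite lerD.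
have fk v : f (k v) = S v.
  apply/eqP; rewrite -subr_eq0; apply/eqP/eq0_normc/eqP.
  rewrite eq_le normc_ge0 andbT (le_trans (fS _ v))//.
  by rewrite subrr rnorm0 mulr0.
have fM x : normc (f x) <= (M + M) * rnorm x.
  by have := fS x 0; rewrite S0 (raddf0 k) !subr0.
have fl : linear f.
  move=> a x y; apply/eqP; rewrite -subr_eq0.
  apply/eqP/eq0_normc.
  apply: (@small_eq0 _ _ ((M + M) * ((normc a + 1) *+ 2))) => [|e e0].
    exact: normc_ge0.
  have [v xv] := dense_approx kd x e0; have [w yw] := dense_approx kd y e0.
  have -> : f (a *: x + y) - (a *: f x + f y) =
      (f (a *: x + y) - S (a *: v + w)) - (a *: (f x - S v) + (f y - S w)).
    by rewrite Sl scalerBr addrACA -opprD opprB addrA subrK.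
  have MM : 0 <= M + M by rewrite addr_ge0.
  have ball z v' : rnorm (z - k v') < e -> normc (f z - S v') <= (M + M) * e.
    by move=> /ltW ze; rewrite (le_trans (fS _ _))// ler_wpM2l.
  have near_axy : rnorm (a *: x + y - k (a *: v + w)) <= (normc a + 1) * e.
    rewrite linearP opprD addrACA -scalerBr (le_trans (ler_rnormD _ _))//.
    by rewrite mulrDl mul1r rnormZ lerD ?(ltW yw)// ler_wpM2l ?normc_ge0// ltW.
  rewrite -rnorm_normc (le_trans (ler_rnorm_distD 0 _ _))// subr0 sub0r rnormN.
  rewrite -mulrA mulrnAl mulr2n mulrDr lerD//.
    by rewrite rnorm_normc (le_trans (fS _ _))// ler_wpM2l.
  rewrite (le_trans (ler_rnormD _ _))// rnormZ !rnorm_normc.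
  rewrite (mulrDl (normc a)) mul1r mulrDr (mulrCA (M + M)).
  by rewrite lerD ?ball// ler_wpM2l ?normc_ge0 ?ball.
have fc : continuous f.
  apply: (@lipschitz_continuous _ _ (norm_qn X) _ _ (M + M)) => x y.
  by rewrite -(zmod_morphism_linear fl) rnorm_normc; exact: fM.
exists (Clf (mem_set (conj fl fc))); split => //.
rewrite rnorm_dual; apply: supnorm_le; first exact: qball0.
move=> x x1; rewrite (le_trans (fM x))// ler_piMr// addr_ge0//.
Qed.

(** * The gauge of the bipolar *)

Section BipolarGauge.
Context {R : realType} {V : preTopologicalLmodType R[i]} {q : quasiNorm V}.
Context {W : normedModType R[i]} (B : topIso (dual q) W).

Let gauge_set (P : V) := [set d : R | 0 < d /\
  exists2 P', prepolar B (polar B (qball q)) P' & P = d%:C *: P'].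

Lemma qnorm_le_gauge_set (P : V) (d : R) : 0 < d -> q P <= d -> gauge_set P d.
Proof.
move=> d0 Pd; split => //; exists (d^-1%:C *: P); last first.
  by rewrite scalerA -rmorphM /= divff ?gt_eqF// scale1r.
move=> Q; apply; rewrite /qball /= qnormZ normc_real ?invr_ge0 ?(ltW d0)//.
by rewrite ler_pdivrMl// mulr1.
Qed.

(** The unit ball is contained in its bipolar. *)
Lemma bipolar_gauge_le (P : V) : bipolar_gauge B P <= q P.
Proof.
apply/ler_addgt0Pr => e e0; apply: ge_inf; first by exists 0 => d [/ltW].
by apply: qnorm_le_gauge_set; rewrite ?lerDl ?(ltW e0)// ltr_wpDl ?qnorm_ge0.
Qed.

(** [B] maps [T / ||T||] into the polar of the unit ball, so this functional
    is bounded by 1 on the bipolar, and by [d] at [P] whenever [P] lies in [d]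
    times the bipolar. *)
Lemma le_bipolar_gauge (T : dual q) (P : V) :
  normc (T P) <= rnorm T * bipolar_gauge B P.
Proof.
have [T0|T0] := eqVneq (rnorm T) 0.
  by rewrite T0 mul0r (rnorm0_eq0 T0) normc0.
have T_gt0 : 0 < rnorm T by rewrite lt_neqAle eq_sym T0 rnorm_ge0.
rewrite -ler_pdivrMl//; apply: lb_le_inf.
  exists (q P + 1); apply: qnorm_le_gauge_set; last by rewrite lerDl.
  by rewrite ltr_wpDl ?qnorm_ge0.
move=> d [d0 [P1 /(_ (B ((rnorm T)^-1%:C *: T))) P1B ->]].
have : normc ((rnorm T)^-1%:C * T P1) <= 1.
  rewrite -lecR normcEC; have := P1B; rewrite /pairing iso_funK; apply.
  move=> P2 qP2; rewrite /pairing iso_funK -normcEC lecR normcM.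
  rewrite normc_real ?invr_ge0 ?(ltW T_gt0)// ler_pdivrMl// mulr1.
  exact: (le_supnorm (dual_bounded T) qP2).
rewrite clfZ !normcM !normc_real ?invr_ge0 ?(ltW T_gt0) ?(ltW d0)// => TP1.
by rewrite mulrCA ler_piMr// ltW.
Qed.

End BipolarGauge.

(** * The dual of the completion *)

Section Restriction.
Context {R : realType} {V : preTopologicalLmodType R[i]} {q : quasiNorm V}.
Context {X : normedModType R[i]} (k : {linear V -> X}).
Hypothesis k_le : forall v, rnorm (k v) <= q v.

Fact dual_comp_subproof (T : topdual X) : (T \o k : V -> R[i]^o) \in clf_pred.
Proof.
apply/mem_set; split => [a u v|]; first by rewrite /= linearP clf_linear.
move=> v; apply: (@continuous_comp _ _ _ k T); last exact: clf_continuous.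
apply: (@lipschitz_continuous _ _ q _ _ 1) => x y.
by rewrite mul1r -raddfB; exact: k_le.
Qed.

Definition dual_comp (T : topdual X) : dual q := Clf (dual_comp_subproof T).

Fact dual_comp_linear : linear dual_comp.
Proof. by move=> a T T'; apply/val_inj/funext. Qed.

HB.instance Definition _ :=
  GRing.isLinear.Build R[i] (topdual X) (dual q) _ dual_comp dual_comp_linear.

Lemma rnorm_dual_comp (T : topdual X) : rnorm (dual_comp T) <= rnorm T.
Proof.
rewrite !rnorm_dual; apply: supnorm_le; first exact: qball0.
move=> v v1; apply: (@le_supnorm _ _ _ _ (k v)); first exact: dual_bounded.
exact: le_trans (k_le v) v1.
Qed.

Lemma dual_comp_inj : dense (range k) -> injective dual_comp.
Proof.
move=> kd T T' TT'; apply/val_inj/funext => x /=.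
have Tk v : T (k v) = T' (k v) by have := congr1 (fun S : dual q => S v) TT'.
apply/eqP; rewrite -subr_eq0; apply/eqP/eq0_normc.
apply: (@small_eq0 _ _ (rnorm T + rnorm T')) => [|e e0].
  exact: normc_ge0.
have [v /ltW xv] := dense_approx kd x e0.
have bound (S : topdual X) : normc (S (x - k v)) <= rnorm S * e.
  apply: le_trans (le_dual_norm S _) _; apply: ler_wpM2l xv.
  exact: (rnorm_ge0 S).
have SB (S : topdual X) : S (x - k v) = S x - S (k v) :=
  zmod_morphism_linear (clf_linear S) x (k v).
have -> : T x - T' x = T (x - k v) - T' (x - k v).
  by rewrite !SB Tk opprB addrA subrK.
rewrite -rnorm_normc (le_trans (ler_rnorm_distD 0 _ _))// subr0 sub0r rnormN.
by rewrite !rnorm_normc mulrDl lerD.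
Qed.

End Restriction.

(** Injectivity of the restriction to [V] is density of the range of [k], and
    surjectivity is the extension of functionals.  The extension is chosen
    functional by functional; uniqueness makes the choice additive. *)
Lemma dual_completion_iso (R : realType) (V : preTopologicalLmodType R[i])
  (q : quasiNorm V) (X : completeNormedModType R[i]) (k : {linear V -> X})
  (W : normedModType R[i]) (B : topIso (dual q) W) :
  is_completion (bipolar_gauge B) k ->
  exists Bt : topIso (topdual X) W, forall T : topdual X,
    exists2 S : dual q, Bt T = B S & forall v, S v = T (k v).
Proof.
move=> [k_gauge k_dense].
have k_le v : rnorm (k v) <= q v by rewrite k_gauge bipolar_gauge_le.
have ext_ex (S : dual q) : exists T : topdual X,
    dual_comp k_le T = S /\ rnorm T <= 2 * rnorm S.
  have [v|T [Tk T_le]] :=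
    dense_extension (rnorm_ge0 S) k_dense (clf_linear S).
    by rewrite k_gauge; exact: le_bipolar_gauge.
  exists T; split; first by apply/val_inj/funext.
  by rewrite mulr_natl mulr2n.
have comp_inj : injective (dual_comp k_le) by exact: dual_comp_inj.
have [ext extE] := choice ext_ex.
have ext_inv S : dual_comp k_le (ext S) = S by have [] := extE S.
have extB S S' : ext S - ext S' = ext (S - S').
  by apply: comp_inj; rewrite raddfB /= !ext_inv.
have comp_continuous : continuous (dual_comp k_le).
  apply: (@lipschitz_continuous _ _ (norm_qn (topdual X)) _ _ 1) => T T'.
  rewrite mul1r -(zmod_morphism_linear (dual_comp_linear k_le)).
  exact: rnorm_dual_comp.
have ext_continuous : continuous ext.
  apply: (@lipschitz_continuous _ _ (norm_qn (dual q)) _ _ 2) => S S'.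
  by rewrite extB; have [] := extE (S' - S).
have extK : cancel (B \o dual_comp k_le) (ext \o iso_inv B).
  move=> T /=; rewrite iso_funK; apply: comp_inj.
  exact: ext_inv.
have extVK : cancel (ext \o iso_inv B) (B \o dual_comp k_le).
  by move=> Q /=; rewrite ext_inv iso_invK.
pose BC : {linear topdual X -> W} := B \o dual_comp k_le.
have BC_continuous : continuous BC.
  move=> T; apply: (@continuous_comp _ _ _ (dual_comp k_le) B).
    exact: comp_continuous.
  exact: iso_continuous.
have BCV_continuous : continuous (ext \o iso_inv B).
  move=> Q; apply: (@continuous_comp _ _ _ (iso_inv B) ext).
    exact: iso_inv_continuous.
  exact: ext_continuous.
exists (@TopIso _ _ _ BC _ extK extVK BC_continuous BCV_continuous) => T.
by exists (dual_comp k_le T).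
Qed.

Theorem theorem2p4 (R : realType) (E : completeNormedModType R[i]) (n : nat)
  (* the quasi-normed space P_Delta(^n E), included in P(^n E) by i *)
  (PD : preTopologicalLmodType R[i]) (qD : quasiNorm PD)
  (i : {linear PD -> hpoly E n})
  (i_inj : injective i)
  (finite_sub : finite_type E n `<=` range i)
  (i_continuous : continuous i)
  (C : R) (C_gt0 : 0 < C) (i_le : forall P : PD, rnorm (i P) <= C * qD P)
  (* the normed space P_Delta'(^n E'), included in P(^n E') by j *)
  (PD' : normedModType R[i])
  (j : {linear PD' -> hpoly (topdual E) n})
  (j_inj : injective j)
  (* the Borel transform *)
  (B : topIso (dual qD) PD')
  (BE : forall (T : dual qD) (phi : topdual E) (P : PD),
    i P = hpow n phi -> j (B T) phi = T P)
  (* the completion of (P_Delta(^n E), p), p the gauge of the bipolar of the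
     unit ball *)
  (X : completeNormedModType R[i]) (k : {linear PD -> X})
  (k_completion : is_completion (bipolar_gauge B) k) :
  exists Bt : topIso (topdual X) PD',
    forall (T : topdual X) (phi : topdual E) (P : PD),
      i P = hpow n phi -> j (Bt T) phi = T (k P).
Proof.
have [Bt BtE] := dual_completion_iso k_completion.
exists Bt => T phi P iP; have [S -> <-] := BtE T.
exact: BE.
Qed.
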